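(* Let $\emptyset=\{x\mid x\neq x\}$, $a'=\{x\mid x=a\vee x\in a\}$ and $\omega=\{x\mid\forall y(\emptyset\in y\wedge\forall z(z\in y\to z'\in y)\to x\in y)\}$. Then: (1) $\Vdash^M\emptyset\in\omega$; (2) $\Vdash^M\forall x(x\in\omega\to x'\in\omega)$; (3) $\omega$ is orthodox; (4) $\Vdash^M\forall y(\emptyset\in y\wedge\forall z(z\in y\to z'\in y)\to\forall x(x\in\omega\to x\in y))$; (5) for every formula $A(x)$, $\Vdash^M A(\emptyset)\wedge\forall x(A(x)\to A(x'))\to\forall y(y\in\omega\to A(y))$.
   Context: The language of the librationist theory £: variables; primitive set constants $\mathcal T$ (truth set) and $\mathcal F$; atomic formulas $a\in b$; formulas $\downarrow AB$ (joint denial), $\forall vA$; terms $\{v\mid A\}$; name terms $\ulcorner X\urcorner$. $\neg A:=\downarrow AA$, other connectives and $\exists$ classical; $\mathcal TA$ abbreviates $\ulcorner A\urcorner\in\mathcal T$. Identity: $a=b:\equiv\forall u(a\in u\to b\in u)$. Semantics: for each $n\in\omega$ and ordinal $\alpha$ a full set $\models^\alpha_n$ of formulas ($\downarrow AB$ in it iff neither $A$ nor $B$; $\forall vA$ in it iff all substitution instances $A^b_v$ are); $(\models^0_n)_n$ a fixed enumeration of full sets; for $\alpha>0$, $\mathcal TA\in\models^\alpha_n$ iff for some $\gamma<\alpha$, $A\in\models^\delta_n$ for all $\gamma\le\delta<\alpha$, and $a\in\{x\mid A\}\in\models^\alpha_n$ iff $\mathcal TA^a_x\in\models^\alpha_n$.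 $\models^\alpha B$ iff $B\in\models^\alpha_n$ for all $n$. $\mathrm{IN}^\alpha(A)$ iff $\models^\beta\mathcal TA$ for all $\beta\ge\alpha$; $\mathrm{IN}(A)$ iff $\exists\alpha\,\mathrm{IN}^\alpha(A)$; $\alpha$ stabilizes $A$ iff ($\mathrm{IN}(A)\Rightarrow\mathrm{IN}^\alpha(A)$) and ($\models^\alpha\mathcal TA\Rightarrow\mathrm{IN}(A)$); $\varpi$ is the least ordinal stabilizing every sentence. $\Vdash^MA$ iff $\mathcal TA\in\models^\varpi_n$ for all $n$; $\Vdash^OA$ iff $A\in\models^\varpi_n$ for all $n$. A formula $A$ with free variables $\vec v$ is orthodox iff $\Vdash^O\forall\vec v(\mathcal TA\vee\mathcal T\neg A)$; a set (term) $a$ is orthodox iff the formula $x\in a$ is orthodox. *)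

(* Defs.v *)
From Stdlib Require Import Arith Classical ClassicalEpsilon.

(** De Bruijn representation: [Abs A] is {v | A} and [All A] is the universal
    quantification of [A]; both bind index 0 of [A].  The names of terms and
    of formulas are transparent to variables: the free variables of a name
    are those of the named expression and substitution acts inside it, as
    quantifying into [T A] requires. *)

Inductive term : Type :=
| Var (i : nat)
| Truth
| Fset
| Abs (A : formula)
| NameT (t : term)
| NameF (A : formula)
with formula : Type :=
| In (a b : term)
| Nor (A B : formula)
| All (A : formula).

Definition up_ren (r : nat -> nat) (i : nat) : nat :=
  match i with 0 => 0 | S j => S (r j) end.

Fixpoint tren (r : nat -> nat) (t : term) : term :=
  match t with
  | Var i => Var (r i)
  | Truth => Truth
  | Fset => Fset
  | Abs A => Abs (fren (up_ren r) A)
  | NameT u => NameT (tren r u)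
  | NameF A => NameF (fren r A)
  end
with fren (r : nat -> nat) (A : formula) : formula :=
  match A with
  | In a b => In (tren r a) (tren r b)
  | Nor B C => Nor (fren r B) (fren r C)
  | All B => All (fren (up_ren r) B)
  end.

Definition shift (t : term) : term := tren S t.

Definition up (s : nat -> term) (i : nat) : term :=
  match i with 0 => Var 0 | S j => shift (s j) end.

Fixpoint tsubst (s : nat -> term) (t : term) : term :=
  match t with
  | Var i => s i
  | Truth => Truth
  | Fset => Fset
  | Abs A => Abs (fsubst (up s) A)
  | NameT u => NameT (tsubst s u)
  | NameF A => NameF (fsubst s A)
  end
with fsubst (s : nat -> term) (A : formula) : formula :=
  match A with
  | In a b => In (tsubst s a) (tsubst s b)
  | Nor B C => Nor (fsubst s B) (fsubst s C)
  | All B => All (fsubst (up s) B)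
  end.

(** [inst A b] is A^b_v, where v (index 0) is the variable of a binder that
    has just been removed from [A]. *)
Definition inst (A : formula) (b : term) : formula :=
  fsubst (fun i => match i with 0 => b | S j => Var j end) A.

(** [subst0 A b] replaces index 0 by [b] while keeping index 0 available, so
    that [b] may itself mention it: A(x) becomes A(b(x)). *)
Definition subst0 (A : formula) (b : term) : formula :=
  fsubst (fun i => match i with 0 => b | S j => Var (S j) end) A.

(** The least [k] such that every free variable has index below [k]. *)
Fixpoint tfv (t : term) : nat :=
  match t with
  | Var i => S i
  | Truth => 0
  | Fset => 0
  | Abs A => pred (ffv A)
  | NameT u => tfv u
  | NameF A => ffv A
  end
with ffv (A : formula) : nat :=
  match A with
  | In a b => Nat.max (tfv a) (tfv b)
  | Nor B C => Nat.max (ffv B) (ffv C)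
  | All B => pred (ffv B)
  end.

Definition sentence (A : formula) : Prop := ffv A = 0.

Fixpoint all_n (k : nat) (A : formula) : formula :=
  match k with 0 => A | S j => All (all_n j A) end.

Definition Neg (A : formula) := Nor A A.
Definition Or (A B : formula) := Neg (Nor A B).
Definition And (A B : formula) := Nor (Neg A) (Neg B).
Definition Imp (A B : formula) := Or (Neg A) B.

Definition T (A : formula) : formula := In (NameF A) Truth.

Definition Eq (a b : term) : formula :=
  All (Imp (In (shift a) (Var 0)) (In (shift b) (Var 0))).

(** An ordinal is presented by a well-founded tree, standing for its rank:
    [osup f] is the least ordinal strictly above all the [f i].  Different
    trees may present the same ordinal, so equality of ordinals is [oeq]. *)

Inductive Ord : Type := osup (X : Type) (f : X -> Ord).
Arguments osup {X} f.

Fixpoint ole (a b : Ord) {struct a} : Prop :=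
  match a with
  | @osup X f =>
      forall i : X, match b with @osup Y g => exists j : Y, ole (f i) (g j) end
  end.

Definition olt (a b : Ord) : Prop :=
  match b with @osup Y g => exists j : Y, ole a (g j) end.

Definition oeq (a b : Ord) : Prop := ole a b /\ ole b a.

Definition ozero : Ord := osup (fun e : Empty_set => match e with end).

Definition full (X : formula -> Prop) : Prop :=
  (forall A B, X (Nor A B) <-> ~ X A /\ ~ X B) /\
  (forall A, X (All A) <-> forall b : term, X (inst A b)).

(** A revision process.  The family at 0 is an arbitrary sequence of full sets,
    and atomic formulas that no clause mentions (such as membership in [Fset],
    in a name or in a free variable) are unconstrained at every stage. *)
Record semantics : Type := Semantics {
  sat : Ord -> nat -> formula -> Prop;
  sat_oeq : forall a b n A, oeq a b -> (sat a n A <-> sat b n A);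
  sat_full : forall a n, full (sat a n);
  sat_T : forall a n A, olt ozero a ->
    (sat a n (T A) <->
     exists c, olt c a /\ forall d, ole c d -> olt d a -> sat d n A);
  sat_Abs : forall a n t A, olt ozero a ->
    (sat a n (In t (Abs A)) <-> sat a n (T (inst A t)))
}.

Section Validity.
Variable M : semantics.

Definition models (a : Ord) (B : formula) : Prop := forall n, sat M a n B.

Definition IN_at (a : Ord) (A : formula) : Prop :=
  forall b, ole a b -> models b (T A).

Definition IN (A : formula) : Prop := exists a, IN_at a A.

Definition stabilizes (a : Ord) (A : formula) : Prop :=
  (IN A -> IN_at a A) /\ (models a (T A) -> IN A).

Definition stabilizes_sentences (a : Ord) : Prop :=
  forall A, sentence A -> stabilizes a A.

Definition is_varpi (a : Ord) : Prop :=
  stabilizes_sentences a /\ forall b, stabilizes_sentences b -> ole a b.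

End Validity.

Lemma ole_refl a : ole a a.
Proof. induction a as [I f IH]; simpl; intro i; exists i; apply IH. Qed.

Lemma ole_trans a b c : ole a b -> ole b c -> ole a c.
Proof.
  revert b c; induction a as [I f IH]; intros [J g] [K h]; simpl; intros H1 H2 i.
  destruct (H1 i) as [j Hj]; destruct (H2 j) as [k Hk].
  exists k; exact (IH _ _ _ Hj Hk).
Qed.

Lemma ole_olt_trans a b c : ole a b -> olt b c -> olt a c.
Proof.
  destruct c as [K h]; simpl; intros H [k Hk]; exists k; eapply ole_trans; eauto.
Qed.

Lemma olt_ole_trans a b c : olt a b -> ole b c -> olt a c.
Proof.
  destruct b as [J g], c as [K h]; simpl; intros [j Hj] H.
  destruct (H j) as [k Hk]; exists k; eapply ole_trans; eauto.
Qed.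

Lemma olt_osup I (f : I -> Ord) i : olt (f i) (osup f).
Proof. exists i; apply ole_refl. Qed.

Lemma ole_total a b : ole a b \/ olt b a.
Proof.
  revert b; induction a as [I f IH]; intros [J g].
  destruct (classic (forall i, olt (f i) (osup g))) as [H|H].
  - left; exact H.
  - right; apply not_all_ex_not in H; destruct H as [i Hi].
    exists i; simpl; intro j.
    destruct (IH i (g j)) as [Hj|Hj].
    + exfalso; apply Hi; exists j; exact Hj.
    + destruct (f i) as [K h]; exact Hj.
Qed.

Lemma olt_wf : well_founded olt.
Proof.
  assert (H : forall a b, ole b a -> Acc olt b).
  { induction a as [I f IH]; intros [J g] Hb; constructor; intros c [j Hj].
    destruct (Hb j) as [i Hi]; apply (IH i); eapply ole_trans; eauto. }
  intro a; exact (H a a (ole_refl a)).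
Qed.

Lemma olt_ole a b : olt a b -> ole a b.
Proof.
  revert b; induction a as [I f IH]; intros [J g] [j Hj] i.
  exists j; apply IH; eapply olt_ole_trans; [apply olt_osup | exact Hj].
Qed.

Lemma ole_least (P : Ord -> Prop) :
  (exists a, P a) -> exists a, P a /\ forall b, P b -> ole a b.
Proof.
  intros [a Ha]; revert Ha; induction a as [a IH] using (well_founded_ind olt_wf).
  intro Ha; destruct (classic (exists b, olt b a /\ P b)) as [[b [Hb Pb]]|H].
  - exact (IH b Hb Pb).
  - exists a; split; [exact Ha|]; intros b Pb.
    destruct (ole_total a b) as [Hab|Hba]; [exact Hab|].
    exfalso; apply H; eauto.
Qed.

Lemma not_IN_cofinal M A : ~ IN M A ->
  exists n, forall b, exists d, ole b d /\ ~ sat M d n A.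
Proof.
  intro H; apply NNPP; intro H1; apply H.
  assert (H2 : forall n, exists b, forall d, ole b d -> sat M d n A).
  { intro n; apply NNPP; intro H2; apply H1; exists n; intro b.
    apply NNPP; intro H3; apply H2; exists b; intros d Hd.
    apply NNPP; intro H4; apply H3; eauto. }
  pose (f := fun n => proj1_sig (constructive_indefinite_description _ (H2 n))).
  assert (Hf : forall n d, ole (f n) d -> sat M d n A)
    by (intro n; exact (proj2_sig (constructive_indefinite_description _ (H2 n)))).
  exists (osup f); intros b Hb n.
  assert (Hn : olt (f n) b) by (eapply olt_ole_trans; [apply olt_osup | exact Hb]).
  apply sat_T.
  - eapply ole_olt_trans; [|exact Hn]; intros [].
  - exists (f n); split; [exact Hn|]; intros d Hd _; exact (Hf n d Hd).
Qed.

Theorem varpi_exists M : exists a, is_varpi M a.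
Proof.
  apply ole_least.
  assert (HI : exists k : formula -> Ord, forall A, IN M A -> IN_at M (k A) A).
  { apply (choice (fun A k => IN M A -> IN_at M k A)); intro A.
    destruct (classic (IN M A)) as [[a Ha]|H];
      [exists a; auto | exists ozero; tauto]. }
  destruct HI as [k Hk].
  assert (HN : exists m : formula -> nat, forall A, ~ IN M A ->
            forall b, exists d, ole b d /\ ~ sat M d (m A) A).
  { apply (choice (fun A n => ~ IN M A ->
              forall b, exists d, ole b d /\ ~ sat M d n A)); intro A.
    destruct (classic (IN M A)) as [H|H]; [exists 0; tauto|].
    destruct (not_IN_cofinal M A H) as [n Hn]; exists n; auto. }
  destruct HN as [m Hm].
  assert (HF : exists g : formula * Ord -> Ord, forall p, ~ IN M (fst p) ->
            ole (snd p) (g p) /\ ~ sat M (g p) (m (fst p)) (fst p)).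
  { apply (choice (fun p d => ~ IN M (fst p) ->
              ole (snd p) d /\ ~ sat M d (m (fst p)) (fst p))); intros [A b]; simpl.
    destruct (classic (IN M A)) as [H|H]; [exists ozero; tauto|].
    destruct (Hm A H b) as [d Hd]; exists d; auto. }
  destruct HF as [g Hg].
  pose (al := fix al (i : nat) : Ord :=
          match i with
          | 0 => osup k
          | S j => osup (fun A => g (A, al j))
          end).
  exists (osup al); intros A _; split.
  - intro H; intros b Hb; apply (Hk A H); eapply ole_trans; [|exact Hb].
    apply olt_ole; eapply olt_ole_trans; [apply olt_osup|].
    apply olt_ole; exact (olt_osup nat al 0).
  - intro HT; apply NNPP; intro H.
    assert (Hpos : olt ozero (osup al)) by (exists 0; intros []).
    destruct (proj1 (sat_T M _ _ _ Hpos) (HT (m A))) as [c [[i Hi] Hc]].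
    destruct (Hg (A, al i) H) as [H1 H2]; simpl in H1, H2; apply H2, Hc.
    + eapply ole_trans; eauto.
    + exists (S i); apply olt_ole; exact (olt_osup _ (fun B => g (B, al i)) A).
Qed.

Definition varpi (M : semantics) : Ord :=
  proj1_sig (constructive_indefinite_description _ (varpi_exists M)).

Lemma varpiP M : is_varpi M (varpi M).
Proof. exact (proj2_sig (constructive_indefinite_description _ (varpi_exists M))). Qed.

Definition provM (M : semantics) (A : formula) : Prop :=
  forall n, sat M (varpi M) n (T A).

Definition provO (M : semantics) (A : formula) : Prop :=
  forall n, sat M (varpi M) n A.

Definition orthodox (M : semantics) (A : formula) : Prop :=
  provO M (all_n (ffv A) (Or (T A) (T (Neg A)))).

Definition orthodox_set (M : semantics) (a : term) : Prop :=
  orthodox M (In (Var 0) (shift a)).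

Definition empty : term := Abs (Neg (Eq (Var 0) (Var 0))).

Definition succ (a : term) : term :=
  Abs (Or (Eq (Var 0) (shift a)) (In (Var 0) (shift a))).

Definition Inductive_set (y : term) : formula :=
  And (In empty y)
      (All (Imp (In (Var 0) (shift y)) (In (succ (Var 0)) (shift y)))).

Definition omega : term :=
  Abs (All (Imp (Inductive_set (Var 0)) (In (Var 1) (Var 0)))).

(* Main.v *)
(** An element of omega at stage d + 1 belongs to every set that is inductive at
    stage d.  At each positive stage omega is itself inductive, so its extension
    decreases along the revision process; hence omega is orthodox, and its extension is constant
    from some stage on.  Beyond that stage, being in omega now means being in
    omega one or two stages later, hence being in every set that is inductive
    now or at the next stage: this is (4), and (5) is the case of {x | A} at the
    next stage, where it has the present extension of A.  Finally the stage
    varpi satisfies every sentence that holds at all sufficiently large stages,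
    and open formulas are handled through the sentence stating the truth of all
    their instances. *)
From Stdlib Require Import Arith Lia Classical ClassicalEpsilon.
Require Import Defs.

Scheme term_mut := Induction for term Sort Prop
  with formula_mut := Induction for formula Sort Prop.
Combined Scheme term_formula_ind from term_mut, formula_mut.

(** * Substitution *)

Definition scons (b : term) (s : nat -> term) (i : nat) : term :=
  match i with 0 => b | S j => s j end.

Lemma subst_eq_below :
  (forall t s s', (forall i, i < tfv t -> s i = s' i) -> tsubst s t = tsubst s' t) /\
  (forall A s s', (forall i, i < ffv A -> s i = s' i) -> fsubst s A = fsubst s' A).
Proof.
  apply term_formula_ind; simpl; intros; auto; f_equal;
    match goal with
    | IH : forall s s', _ -> ?f s ?t = _ |- ?f _ ?t = _ => apply IH
    end; try (intros; match goal with H : forall i, _ -> _ = _ |- _ => apply H; lia end);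
    intros [|i] Hi; simpl; f_equal; auto;
    match goal with H : forall i, _ -> _ = _ |- _ => apply H; lia end.
Qed.

Lemma fsubst_ext A s s' : (forall i, s i = s' i) -> fsubst s A = fsubst s' A.
Proof. intro H; apply subst_eq_below; auto. Qed.

Lemma subst_id :
  (forall t s, (forall i, s i = Var i) -> tsubst s t = t) /\
  (forall A s, (forall i, s i = Var i) -> fsubst s A = A).
Proof.
  apply term_formula_ind; simpl; intros; f_equal; auto;
    match goal with
    | IH : forall s, _ -> _ = _, H : forall i, _ = _ |- _ =>
        apply IH; intros [|i]; simpl; [|rewrite H]; auto
    end.
Qed.

(** Here and in the next composition lemmas the composite is a separate map tied by a pointwise
    equation: under a binder the lifted maps agree only pointwise, and this form lets the induction
    hypothesis apply to them. *)
Lemma subst_ren :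
  (forall t r s s', (forall i, s (r i) = s' i) -> tsubst s (tren r t) = tsubst s' t) /\
  (forall A r s s', (forall i, s (r i) = s' i) -> fsubst s (fren r A) = fsubst s' A).
Proof.
  apply term_formula_ind; simpl; intros; auto; f_equal; eauto;
    match goal with
    | IH : forall r s s', _ -> _ = _, H : forall i, _ = _ |- _ =>
        apply IH; intros [|i]; simpl; [|rewrite H]; auto
    end.
Qed.

Lemma ren_ren :
  (forall t r r' q, (forall i, r' (r i) = q i) -> tren r' (tren r t) = tren q t) /\
  (forall A r r' q, (forall i, r' (r i) = q i) -> fren r' (fren r A) = fren q A).
Proof.
  apply term_formula_ind; simpl; intros; auto; f_equal; eauto;
    match goal with
    | IH : forall r s s', _ -> _ = _, H : forall i, _ = _ |- _ =>
        apply IH; intros [|i]; simpl; [|rewrite H]; auto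
    end.
Qed.

Lemma tren_shift r t : tren (up_ren r) (shift t) = shift (tren r t).
Proof.
  unfold shift; rewrite (proj1 ren_ren t S (up_ren r) (fun i => S (r i))) by auto.
  symmetry; apply (proj1 ren_ren); auto.
Qed.

Lemma ren_subst :
  (forall t r s s', (forall i, tren r (s i) = s' i) -> tren r (tsubst s t) = tsubst s' t) /\
  (forall A r s s', (forall i, tren r (s i) = s' i) -> fren r (fsubst s A) = fsubst s' A).
Proof.
  apply term_formula_ind; simpl; intros; auto; f_equal; eauto;
    match goal with
    | IH : forall r s s', _ -> _ = _, H : forall i, _ = _ |- _ =>
        apply IH; intros [|i]; simpl; [|rewrite tren_shift, H]; auto
    end.
Qed.

Lemma tsubst_shift s t : tsubst (up s) (shift t) = shift (tsubst s t).
Proof.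
  unfold shift.
  rewrite (proj1 subst_ren t S (up s) (fun i => shift (s i))) by auto.
  symmetry; apply (proj1 ren_subst); auto.
Qed.

Lemma subst_subst :
  (forall t s s' q, (forall i, tsubst s' (s i) = q i) -> tsubst s' (tsubst s t) = tsubst q t) /\
  (forall A s s' q, (forall i, tsubst s' (s i) = q i) -> fsubst s' (fsubst s A) = fsubst q A).
Proof.
  apply term_formula_ind; simpl; intros; auto; f_equal; eauto;
    match goal with
    | IH : forall r s s', _ -> _ = _, H : forall i, _ = _ |- _ =>
        apply IH; intros [|i]; simpl; [|rewrite tsubst_shift, H]; auto
    end.
Qed.

Lemma tsubst_scons_shift b t : tsubst (scons b Var) (shift t) = t.
Proof.
  unfold shift; rewrite (proj1 subst_ren t S _ Var) by auto.
  apply (proj1 subst_id); auto.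
Qed.

Lemma inst_scons A b : inst A b = fsubst (scons b Var) A.
Proof. apply fsubst_ext; intros [|i]; reflexivity. Qed.

Lemma inst_up A s b : inst (fsubst (up s) A) b = fsubst (scons b s) A.
Proof.
  rewrite inst_scons; apply (proj2 subst_subst).
  intros [|i]; [reflexivity | apply tsubst_scons_shift].
Qed.

Lemma fsubst_inst A b s : fsubst s (inst A b) = inst (fsubst (up s) A) (tsubst s b).
Proof.
  rewrite inst_up, inst_scons; apply (proj2 subst_subst).
  intros [|i]; reflexivity.
Qed.

(** The two substitutions commute because [succ (Var 0)] mentions only index 0, which [up s]
    fixes. *)
Lemma fsubst_subst0_succ A s :
  fsubst (up s) (subst0 A (succ (Var 0))) = subst0 (fsubst (up s) A) (succ (Var 0)).
Proof.
  unfold subst0.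
  rewrite (proj2 subst_subst A _ (up s) (scons (succ (Var 0)) (fun i => shift (s i))))
    by (intros [|i]; reflexivity).
  symmetry; apply (proj2 subst_subst); intros [|i]; [reflexivity|]; simpl.
  unfold shift; rewrite (proj1 subst_ren (s i) S _ (fun j => Var (S j))) by auto.
  (* Inserting the identity substitution turns the renaming [S] into the substitution of its
     values. *)
  rewrite <- (proj1 (subst_id) (s i) Var) at 2 by auto.
  symmetry; apply (proj1 ren_subst); auto.
Qed.

Lemma inst_subst0_succ A b : inst (subst0 A (succ (Var 0))) b = inst A (succ b).
Proof.
  rewrite !inst_scons; apply (proj2 subst_subst); intros [|i]; reflexivity.
Qed.

Lemma ffv_all_n k A : ffv (all_n k A) = ffv A - k.
Proof. induction k as [|k IH]; simpl; [|rewrite IH]; lia. Qed.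

Lemma sentence_subst A s : sentence A -> fsubst s A = A.
Proof.
  intro H; rewrite <- (proj2 subst_id A Var) at 2 by auto.
  apply subst_eq_below; rewrite H; lia.
Qed.

(** * Full sets *)

Section Full.
Variable X : formula -> Prop.
Hypothesis HX : full X.

Lemma full_Nor A B : X (Nor A B) <-> ~ X A /\ ~ X B.
Proof. apply HX. Qed.

Lemma full_All A : X (All A) <-> forall b, X (inst A b).
Proof. apply HX. Qed.

Lemma full_Neg A : X (Neg A) <-> ~ X A.
Proof. unfold Neg; rewrite full_Nor; tauto. Qed.

Lemma full_Or A B : X (Or A B) <-> X A \/ X B.
Proof. unfold Or; rewrite full_Neg, full_Nor; tauto. Qed.

Lemma full_And A B : X (And A B) <-> X A /\ X B.
Proof. unfold And; rewrite full_Nor, !full_Neg; tauto. Qed.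

Lemma full_Imp A B : X (Imp A B) <-> (X A -> X B).
Proof. unfold Imp; rewrite full_Or, full_Neg; tauto. Qed.

Lemma full_All_Imp A B :
  X (All (Imp A B)) <-> forall b, X (inst A b) -> X (inst B b).
Proof.
  rewrite full_All; split; intros H b; specialize (H b);
    change (inst (Imp A B) b) with (Imp (inst A b) (inst B b)) in *;
    apply full_Imp; exact H.
Qed.

(** The substitution [s] makes the induction go through, since removing one quantifier leaves a
    substitution behind. *)
Lemma full_all_n k A s :
  X (fsubst s (all_n k A)) <->
  forall s', (forall i, s' (k + i) = s i) -> X (fsubst s' A).
Proof.
  revert s; induction k as [|k IH]; intro s; simpl.
  - split.
    + intros H s' Hs; rewrite (fsubst_ext A s' s); auto.
    + intro H; apply H; auto.
  - rewrite full_All; split.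
    (* The outermost of the [S k] quantifiers binds index [k] of [A]. *)
    + intros H s' Hs; specialize (H (s' k)); rewrite inst_up, IH in H.
      apply H; intros [|i]; simpl.
      * f_equal; lia.
      * rewrite <- Hs; f_equal; lia.
    + intros H b; rewrite inst_up, IH; intros s' Hs; apply H; intro i.
      rewrite <- plus_Sn_m, Nat.add_succ_comm; apply (Hs (S i)).
Qed.

Lemma full_Inductive_set y :
  X (Inductive_set y) <->
  X (In empty y) /\ forall z, X (In z y) -> X (In (succ z) y).
Proof.
  unfold Inductive_set; rewrite full_And, full_All_Imp.
  assert (E : forall z, inst (In (Var 0) (shift y)) z = In z y /\
                        inst (In (succ (Var 0)) (shift y)) z = In (succ z) y).
  { intro z; rewrite !inst_scons; simpl; rewrite tsubst_scons_shift; auto. }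
  split; intros [H0 H]; split; auto; intro z; destruct (E z) as [E1 E2];
    specialize (H z); rewrite E1, E2 in *; exact H.
Qed.

Lemma full_omega_body t :
  X (inst (All (Imp (Inductive_set (Var 0)) (In (Var 1) (Var 0)))) t) <->
  forall y, X (Inductive_set y) -> X (In t y).
Proof.
  change (X (All (Imp (Inductive_set (Var 0)) (In (shift t) (Var 0)))) <->
          forall y, X (Inductive_set y) -> X (In t y)).
  rewrite full_All_Imp.
  assert (E : forall y, inst (In (shift t) (Var 0)) y = In t y).
  { intro y; rewrite inst_scons; simpl; rewrite tsubst_scons_shift; auto. }
  split; intros H y; specialize (H y); rewrite E in *; exact H.
Qed.

End Full.

(** * Stages *)

Definition osuc (a : Ord) : Ord := osup (fun _ : unit => a).

Lemma olt_osuc a : olt a (osuc a).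
Proof. exact (olt_osup unit (fun _ => a) tt). Qed.

Lemma olt_osuc_ole a b : olt a (osuc b) -> ole a b.
Proof. intros [_ H]; exact H. Qed.

Lemma osuc_ole a b : olt a b -> ole (osuc a) b.
Proof. destruct b; intros H []; exact H. Qed.

Lemma ozero_ole a : ole ozero a.
Proof. intros []. Qed.

Lemma ozero_olt_osuc a : olt ozero (osuc a).
Proof. exact (ole_olt_trans _ _ _ (ozero_ole a) (olt_osuc a)). Qed.

(** The last clause transfers any strict upper bound of both ordinals to their maximum. *)
Lemma ole_max a b : exists c, ole a c /\ ole b c /\ (c = a \/ c = b).
Proof.
  destruct (ole_total a b) as [H|H].
  - exists b; auto using ole_refl.
  - exists a; auto using ole_refl, olt_ole.
Qed.

Section Stages.
Variable M : semantics.

(** Every tail of the stages below [osuc a] contains [a], and the tail from [a] on contains only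
    [a], up to [oeq]. *)
Lemma sat_T_osuc a n A : sat M (osuc a) n (T A) <-> sat M a n A.
Proof.
  rewrite sat_T by apply ozero_olt_osuc; split.
  - intros [c [Hc H]]; apply H; [apply olt_osuc_ole, Hc | apply olt_osuc].
  - intro H; exists a; split; [apply olt_osuc|]; intros d H1 H2.
    refine (proj1 (sat_oeq M a d n A _) H); split; [|apply olt_osuc_ole]; auto.
Qed.

Lemma sat_Abs_osuc a n t A :
  sat M (osuc a) n (In t (Abs A)) <-> sat M a n (inst A t).
Proof. rewrite sat_Abs by apply ozero_olt_osuc; apply sat_T_osuc. Qed.

Lemma eventually_T a A :
  (forall b, ole a b -> models M b A) ->
  forall b, ole (osuc a) b -> models M b (T A).
Proof.
  intros H b Hb n.
  assert (Hab : olt a b) by (eapply olt_ole_trans; [apply olt_osuc | exact Hb]).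
  apply sat_T; [exact (ole_olt_trans _ _ _ (ozero_ole a) Hab)|].
  exists a; split; [exact Hab|]; intros d Hd _; exact (H d Hd n).
Qed.

(* Stability of [A] at varpi gives [T A] one stage later, which is [A] at
   varpi; thus it does not matter whether varpi is zero. *)
Lemma sentence_eventually_provO a A :
  sentence A -> (forall b, ole a b -> models M b A) -> provO M A.
Proof.
  intros HA H n.
  apply sat_T_osuc.
  apply (proj1 (proj1 (varpiP M) A HA)).
  - exists (osuc a); exact (eventually_T a A H).
  - apply olt_ole, olt_osuc.
Qed.

Lemma eventually_provM a A :
  (forall b s, ole a b -> models M b (fsubst s A)) -> provM M A.
Proof.
  intro H.
  set (C := all_n (ffv A) (T A)).
  assert (HC : sentence C).
  { unfold C, sentence; rewrite ffv_all_n; simpl; lia. }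
  assert (HO : provO M C).
  { apply (sentence_eventually_provO (osuc a)); [exact HC|].
    intros b Hb n; rewrite <- (sentence_subst C Var HC).
    apply full_all_n; [apply sat_full|]; intros s _.
    apply (eventually_T a (fsubst s A)); auto. }
  intro n; specialize (HO n).
  (* The closed [C] absorbs any substitution; this one matches [Var] beyond the [ffv A] quantified
     indices, so [Var] itself is an admissible instance. *)
  rewrite <- (sentence_subst C (fun i => Var (ffv A + i)) HC) in HO.
  rewrite <- (proj2 subst_id (T A) Var) by auto.
  apply (proj1 (full_all_n _ (sat_full M _ n) _ _ _) HO); auto.
Qed.

(** * The extension of omega *)

Definition omega_at (a : Ord) (n : nat) (t : term) : Prop := sat M a n (In t omega).

Lemma omega_atE a n t : olt ozero a ->
  (omega_at a n t <->
   exists c, olt c a /\ forall d, ole c d -> olt d a ->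
     forall y, sat M d n (Inductive_set y) -> sat M d n (In t y)).
Proof.
  intro Ha; unfold omega_at, omega; rewrite sat_Abs, sat_T by exact Ha.
  split; intros [c [Hc H]]; exists c; split; auto; intros d H1 H2;
    apply full_omega_body; auto; apply sat_full.
Qed.

Lemma omega_at_empty a n : olt ozero a -> omega_at a n empty.
Proof.
  intro Ha; apply omega_atE; [exact Ha|].
  exists ozero; split; [exact Ha|]; intros d _ _ y Hy.
  apply full_Inductive_set in Hy; [apply Hy | apply sat_full].
Qed.

Lemma omega_at_succ a n t : olt ozero a -> omega_at a n t -> omega_at a n (succ t).
Proof.
  intros Ha; rewrite !omega_atE by exact Ha; intros [c [Hc H]].
  exists c; split; [exact Hc|]; intros d H1 H2 y Hy.
  assert (Hy' := Hy); apply full_Inductive_set in Hy'; [|apply sat_full].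
  apply Hy', H; auto.
Qed.

Lemma omega_inductive a n : olt ozero a -> sat M a n (Inductive_set omega).
Proof.
  intro Ha; apply full_Inductive_set; [apply sat_full|]; split.
  - exact (omega_at_empty a n Ha).
  - intros z; exact (omega_at_succ a n z Ha).
Qed.

(** By induction on [b]: membership at [b] puts [t] in every inductive set on a tail of stages below
    [b], in particular in [omega] itself, and the induction hypothesis goes down from there to
    [a]. *)
Lemma omega_at_decreasing a b n t :
  olt ozero a -> ole a b -> omega_at b n t -> omega_at a n t.
Proof.
  intro Ha; induction b as [b IH] using (well_founded_ind olt_wf); intros Hab Hb.
  destruct (ole_total b a) as [Hba|Hlt].
  { exact (proj1 (sat_oeq M b a n _ (conj Hba Hab)) Hb). }
  apply omega_atE in Hb; [|exact (olt_ole_trans _ _ _ Ha Hab)].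
  destruct Hb as [c [Hc H]].
  (* The stage [d] lies in the tail from [c], is at least [a], and is still below [b]. *)
  destruct (ole_max c a) as [d [H1 [H2 Hd]]].
  assert (Hdb : olt d b) by (destruct Hd; subst; assumption).
  apply (IH d Hdb H2), H; auto.
  apply omega_inductive, (olt_ole_trans _ _ _ Ha H2).
Qed.

(** A pair of an index and a term that leaves [omega] never returns, so a stage above one chosen
    failure for each such pair suffices. *)
Lemma omega_at_stable : exists a, olt ozero a /\
  forall b c n t, ole a b -> ole a c -> omega_at b n t -> omega_at c n t.
Proof.
  assert (HF : exists f : nat * term -> Ord, forall p,
             (exists d, olt ozero d /\ ~ omega_at d (fst p) (snd p)) ->
             olt ozero (f p) /\ ~ omega_at (f p) (fst p) (snd p)).
  { apply (choice (fun p d => (exists e, olt ozero e /\ ~ omega_at e (fst p) (snd p)) ->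
                     olt ozero d /\ ~ omega_at d (fst p) (snd p))); intro p.
    destruct (classic (exists e, olt ozero e /\ ~ omega_at e (fst p) (snd p)))
      (* Pairs that never leave get the default stage [ozero]. *)
      as [[e He]|H]; [exists e; auto | exists ozero; tauto]. }
  destruct HF as [f Hf].
  assert (H0 : olt ozero (osup f)) by (exists (0, empty); apply ozero_ole).
  exists (osup f); split; [exact H0|].
  intros b c n t Hb Hc Ht; apply NNPP; intro Hn.
  destruct (Hf (n, t)) as [H1 H2].
  { exists c; split; [exact (olt_ole_trans _ _ _ H0 Hc) | exact Hn]. }
  apply H2, (omega_at_decreasing _ b); auto.
  apply olt_ole; eapply olt_ole_trans; [apply olt_osup | exact Hb].
Qed.

(** Since the extension decreases, [t] is either absent from some positive stage on or present at
    all positive stages below [a]. Stage 0 is arbitrary, so the second tail starts at [osuc ozero],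
    which must lie below [a]. *)
Lemma omega_decided a n t : olt (osuc ozero) a ->
  sat M a n (T (In t omega)) \/ sat M a n (T (Neg (In t omega))).
Proof.
  intro Ha.
  assert (H0 : olt ozero a) by (eapply ole_olt_trans; [apply ozero_ole | exact Ha]).
  destruct (classic (exists d, olt ozero d /\ olt d a /\ ~ omega_at d n t))
    as [[d [H1 [H2 H3]]]|H].
  - right; apply sat_T; [exact H0|]; exists d; split; [exact H2|]; intros e He _.
    apply full_Neg; [apply sat_full|]; intro Ht.
    exact (H3 (omega_at_decreasing d e n t H1 He Ht)).
  - left; apply sat_T; [exact H0|]; exists (osuc ozero); split; [exact Ha|].
    intros d Hd Hda; apply NNPP; intro Hn; apply H; exists d; repeat split; auto.
    eapply olt_ole_trans; [apply olt_osuc | exact Hd].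
Qed.

Lemma omega_at_osuc a n y t :
  omega_at (osuc a) n t -> sat M a n (Inductive_set y) -> sat M a n (In t y).
Proof.
  intros H; apply (sat_Abs_osuc a n t) in H.
  exact (proj1 (full_omega_body _ (sat_full M a n) t) H y).
Qed.

End Stages.

(** * The induction schema and the five clauses *)

Definition induction_formula (A : formula) : formula :=
  Imp (And (inst A empty) (All (Imp A (subst0 A (succ (Var 0))))))
      (All (Imp (In (Var 0) omega) A)).

(** Instances of the schema are closed under substitution for parameters, so validity of every
    instance at a stage covers all its substitution instances. *)
Lemma fsubst_induction_formula A s :
  fsubst s (induction_formula A) = induction_formula (fsubst (up s) A).
Proof.
  unfold induction_formula.
  change (inst (fsubst (up s) A) empty) with (inst (fsubst (up s) A) (tsubst s empty)).
  rewrite <- fsubst_inst, <- fsubst_subst0_succ; reflexivity.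
Qed.

Theorem theorem10p0p2 (M : semantics) :
  provM M (In empty omega) /\
  provM M (All (Imp (In (Var 0) omega) (In (succ (Var 0)) omega))) /\
  orthodox_set M omega /\
  provM M (All (Imp (Inductive_set (Var 0))
                    (All (Imp (In (Var 0) omega) (In (Var 0) (Var 1)))))) /\
  (forall A : formula,
     provM M (Imp (And (inst A empty) (All (Imp A (subst0 A (succ (Var 0))))))
                  (All (Imp (In (Var 0) omega) A)))).
Proof.
  destruct (omega_at_stable M) as [a [Ha Hs]].
  split; [|split; [|split; [|split]]].
  - apply (eventually_provM M a); intros b s Hb n.
    exact (omega_at_empty M b n (olt_ole_trans _ _ _ Ha Hb)).
  - apply (eventually_provM M a); intros b s Hb n.
    rewrite sentence_subst by reflexivity.
    apply full_All_Imp; [apply sat_full|]; intro t.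
    exact (omega_at_succ M b n t (olt_ole_trans _ _ _ Ha Hb)).
  - apply (sentence_eventually_provO M (osuc (osuc ozero))); [reflexivity|].
    intros b Hb n; apply full_All; [apply sat_full|]; intro t.
    apply (full_Or _ (sat_full M b n) (T (In t omega)) (T (Neg (In t omega)))).
    apply omega_decided; eapply olt_ole_trans; [apply olt_osuc | exact Hb].
  - apply (eventually_provM M a); intros b s Hb n.
    rewrite sentence_subst by reflexivity.
    apply full_All_Imp; [apply sat_full|]; intros y Hy.
    apply (full_All_Imp _ (sat_full M b n) (In (Var 0) omega) (In (Var 0) (shift y))).
    intros t Ht; rewrite inst_scons; simpl; rewrite tsubst_scons_shift.
    (* Stability moves membership in [omega] from [b] up to [osuc b], where it speaks of the sets
       inductive at [b]. *)
    apply omega_at_osuc; [apply (Hs b); auto | exact Hy].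
    eapply ole_trans; [exact Hb | apply olt_ole, olt_osuc].
  - intro A; apply (eventually_provM M a); intros b s Hb n.
    change (sat M b n (fsubst s (induction_formula A))).
    rewrite fsubst_induction_formula; generalize (fsubst (up s) A); clear A s; intro A.
    assert (F := sat_full M b n).
    assert (Hb' : ole a (osuc (osuc b))).
    { do 2 (eapply ole_trans; [|apply olt_ole, olt_osuc]); exact Hb. }
    unfold induction_formula; apply full_Imp; [exact F|].
    rewrite full_And, !full_All_Imp by exact F.
    intros [H0 HS] t Ht.
    (* [Abs A] is tested at [osuc b], hence membership in [omega] is taken at [osuc (osuc b)]. *)
    apply sat_Abs_osuc, omega_at_osuc; [apply (Hs b); auto|].
    apply full_Inductive_set; [apply sat_full|]; split.
    + apply sat_Abs_osuc, H0.
    + intros z Hz; apply sat_Abs_osuc; apply sat_Abs_osuc in Hz.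
      rewrite <- inst_subst0_succ; exact (HS z Hz).
Qed.
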